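(* If $2^{\mathfrak p}>\mathfrak c$, then there is a sequentially compact separable Hausdorff space of cardinality $>\mathfrak c$. In particular, such a space exists if $\mathfrak p=\mathfrak c$.
   Context: $\mathfrak c=2^{\aleph_0}$. The pseudointersection number $\mathfrak p$ is the least cardinality of a family $\mathcal F$ of infinite subsets of $\omega$ such that every finite subfamily of $\mathcal F$ has infinite intersection but there is no infinite $P\subseteq\omega$ with $P\setminus F$ finite for all $F\in\mathcal F$. A space is sequentially compact if every sequence in it has a convergent subsequence. *)

(* Defs.v *)
From mathcomp Require Import all_boot all_order.
From mathcomp Require Import all_classical topology sequences.

Set Implicit Arguments.
Unset Strict Implicit.
Unset Printing Implicit Defensive.

Import Order.TTheory.
Local Open Scope classical_set_scope.
Local Open Scope card_scope.

(* A cardinal is represented by any set having that cardinality; cardinals are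
   compared with [card_le] and [card_eq]. *)

Definition card_lt T U (A : set T) (B : set U) : bool :=
  (A #<= B) && ~~ (B #<= A).

Definition power_set T (A : set T) : set (set T) := [set B | B `<=` A].

Definition continuum : set (set nat) := power_set [set: nat].

Definition strong_fip (F : set (set nat)) : Prop :=
  forall G, G `<=` F -> finite_set G -> infinite_set (\bigcap_(A in G) A).

Definition pseudointersection (F : set (set nat)) (P : set nat) : Prop :=
  infinite_set P /\ forall A, F A -> finite_set (P `\` A).

Definition pseudointersection_free (F : set (set nat)) : Prop :=
  [/\ forall A, F A -> infinite_set A,
      strong_fip F &
      ~ exists P, pseudointersection F P].

Lemma pseudointersection_free_exists : exists F, pseudointersection_free F.
Proof.
have [U [UU FU]] := ultraFilterLemma frechet_properfilter_nat.
have Uinf A : U A -> infinite_set A.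
  move=> UA finA; have /FU UnA : frechet_filter (~` A).
    by rewrite /frechet_filter /= setCK.
  have [x []] : (A `&` ~` A) !=set0 by apply: (@filter_ex _ U); exact: filterI.
  by [].
exists U; split => // [G GU /finite_fsetP[X GX]|[P [Pinf PU]]].
  apply: Uinf; rewrite GX; apply: filter_bigI => A AX.
  by apply: GU; rewrite GX.
have [|f [fincr _ fP]] := @infinite_increasing_seq_wf _ nat P _ Pinf 0%N.
  by move=> n; apply: sub_finite_set (finite_II n.+1) => m /=.
have finj : injective f.
  by move=> x y fxy; apply/eqP; rewrite eqn_leq -!fincr fxy lexx.
have rinf (g : nat -> nat) : injective g -> infinite_set (range (f \o g)).
  move=> ginj rfin; apply: infinite_nat; apply: card_le_finite rfin.
  by rewrite (card_le_eqr (inj_card_eq _))// => x y _ _ /finj/ginj.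
have [UB|UB] := in_ultra_setVsetC (range (f \o double)) UU.
  apply: (rinf (fun n => n.*2.+1)) => [x y [] /double_inj//|].
  apply: sub_finite_set (PU _ UB) => _ [n _ <-]; split; first exact: fP.
  move=> [m _ /finj] /(congr1 odd); rewrite oddS !odd_double.
  by [].
apply: (rinf double double_inj).
apply: sub_finite_set (PU _ UB) => _ [n _ <-]; split; first exact: fP.
by apply; exists n.
Qed.

Lemma card_le_least (T : pointedType) (P : set (set T)) :
  P !=set0 -> exists2 A, P A & forall B, P B -> A #<= B.
Proof.
move=> [A0 PA0].
pose C (S : set (set T -> T)) := forall A, P A ->
  (forall f, S f -> A (f A)) /\ {in S &, injective (fun f => f A)}.
have [S [CS maxS]] : exists S, C S /\ forall S', S `<` S' -> ~ C S'.
  apply: Zorn_bigcup => F FC Ftot A PA; split=> [f [X FX Xf]|f g].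
    by have [+ _] := FC _ FX _ PA; apply.
  rewrite !inE => -[X FX Xf] [Y FY Yg].
  have [XY|YX] := Ftot _ _ FX FY.
    by have [_] := FC _ FY _ PA; apply; rewrite inE //; exact: XY.
  by have [_] := FC _ FX _ PA; apply; rewrite inE //; exact: YX.
have [A PA SA] : exists2 A, P A & forall x, A x -> exists2 f, S f & f A = x.
  apply: contrapT => /forall2NP noA.
  have [g gP] : {g : set T -> T & forall A, P A ->
      A (g A) /\ forall f, S f -> f A <> g A}.
    apply: (@choice _ _ (fun A x => P A -> A x /\ forall f, S f -> f A <> x)).
    move=> A; have [nPA|/existsNP[x /not_implyP[Ax Sx]]] := noA A.
      by exists point.
    exists x => _; split=> // f Sf fx.
    by apply: Sx; exists f.
  apply: (maxS (S `|` [set g])).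
    split; first exact: subsetUl.
    by move=> /(_ g (or_intror erefl)) Sg; have [_ /(_ _ Sg)] := gP _ PA0.
  move=> A PA; have [Ag ng] := gP _ PA; have [SA Sinj] := CS _ PA.
  split=> [f [/SA//|->//]|f h].
  rewrite !inE => -[Sf|->] [Sh|->]//.
  - by apply: Sinj; rewrite inE.
  - by move=> /(ng _ Sf).
  - by move=> /esym/(ng _ Sh).
exists A => // B PB.
have AS : A #<= S.
  apply: card_le_trans (card_image_le (fun f => f A) S).
  by apply: subset_card_le => x /SA[f Sf <-]; exists f.
apply: (card_le_trans AS); have [SB Sinj] := CS _ PB.
rewrite -(card_le_eql (inj_card_eq Sinj)).
by apply: subset_card_le => _ [f Sf <-]; exact: SB.
Qed.

(* The cardinal p, represented by a chosen family of least cardinality. *)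
Definition pseudointersection_number : set (set nat) :=
  s2val (cid2 (card_le_least pseudointersection_free_exists)).

Lemma pseudointersection_number_free :
  pseudointersection_free pseudointersection_number.
Proof. by rewrite /pseudointersection_number; case: cid2. Qed.

Lemma pseudointersection_number_le F :
  pseudointersection_free F -> pseudointersection_number #<= F.
Proof. by rewrite /pseudointersection_number; case: cid2 => ? ? le_ /le_. Qed.

Definition sequentially_compact (X : topologicalType) : Prop :=
  forall u : nat -> X, exists2 f : nat -> nat, increasing_seq f &
    exists l : X, u \o f @ \oo --> l.

Definition separable_space (X : topologicalType) : Prop :=
  exists2 D : set X, countable D & dense D.

(* Main.v *)
Require Import Defs.
From mathcomp Require Import all_boot all_order.
From mathcomp Require Import all_classical topology sequences.

Set Implicit Arguments.
Unset Strict Implicit.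
Unset Printing Implicit Defensive.

Import Order.TTheory.
Local Open Scope classical_set_scope.
Local Open Scope card_scope.

(** Write [c] for the continuum and [p] for the pseudointersection number, and
    assume [2^p > c].  Let [I] be the shortest initial segment, in a well-order
    of a family witnessing [p], that satisfies [2^I > c].  Its proper initial
    segments have at most [c] subsets, hence fewer than [p] elements, and
    [c^omega = c] shows that countable subsets of [I] are bounded.

    The space is built from a tree of infinite sets of integers.  Each
    [f : I -> bool] is a branch, [node i f] depends only on the values of [f] up
    to [i], it decreases modulo finite sets as [i] grows, and nodes of
    incompatible branches are almost disjoint.  The recursion passes limit
    stages because a decreasing chain of fewer than [p] infinite sets has a
    pseudointersection.  Send [n] to the function telling which nodes contain
    [n], and let [X] be the closure of the image in [2^nodes].  Then [X] is
    Hausdorff and separable, and it has at least [2^I > c] points, because an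
    ultrafilter that contains all nodes along a branch determines a point of
    [X] and distinct branches give distinct points.

    Sequential compactness of [X] needs two facts.  A point of [X] outside the
    image lies on a chain of nodes, so a sequence of such points traces a family
    of sets of indices any two of which are nested or disjoint; such a family
    never splits all infinite sets ([laminar_decided]).  A sequence in the image
    has a convergent subsequence as soon as every infinite [Z] has an infinite
    subset that is almost contained in or almost disjoint from each node
    ([node_decided]); this is what the tree is designed for.  If [Z] has no such
    subset, then it can be split along the tree over and over, and [omega] many
    splittings produce [2^omega] many branches that meet [Z] at a common level
    [i], which exists since [I] has uncountable cofinality.  As there are only
    [c] such sets [Z], at level [i] one can assign to each of them a branch of
    its own ([injective_choice]), and the stem chosen there is taken inside [Z];
    the part of the stem left out of both its successor nodes is an infinite
    subset of [Z] that no node splits, a contradiction ([no_undecidable]). *)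

(** * Almost inclusion *)

Definition almost_sub (A B : set nat) := finite_set (A `\` B).
Local Notation "A '<=*' B" := (almost_sub A B) (at level 70).

Lemma almost_sub_sub A B : A `<=` B -> A <=* B.
Proof. by rewrite -setD_eq0 /almost_sub => ->. Qed.

Lemma almost_sub_trans B A C : A <=* B -> B <=* C -> A <=* C.
Proof.
move=> AB BC; have: finite_set (A `\` B `|` B `\` C) by rewrite finite_setU.
apply: sub_finite_set => n [An nCn].
by have [Bn|nBn] := pselect (B n); [right|left].
Qed.

Lemma almost_subI A B C : A <=* B -> A <=* C -> A <=* B `&` C.
Proof. by rewrite /almost_sub setDIr finite_setU. Qed.

Lemma almost_sub_infinite A B :
  A <=* B -> infinite_set A -> infinite_set (A `&` B).
Proof.
move=> AB Ainf ABfin; apply: Ainf.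
by rewrite -(setDUK (@subIsetl _ A B)) finite_setU setDIr setDv set0U.
Qed.

Lemma almost_sub_meet A B C :
  A <=* B -> finite_set (B `&` C) -> finite_set (A `&` C).
Proof.
move=> AB BC; have: finite_set (A `\` B `|` B `&` C) by rewrite finite_setU.
apply: sub_finite_set => n [An Cn].
by have [Bn|nBn] := pselect (B n); [right|left].
Qed.

(** A sequence with values in a product of two-point spaces converges along the
    enumeration of [Q] exactly when [Q] decides the sets of indices where the
    coordinates hold. *)
Definition decides (Q U : set nat) := Q <=* U \/ finite_set (Q `&` U).

Lemma infinite_cofinal (Z : set nat) n :
  infinite_set Z -> exists2 m, Z m & (n <= m)%N.
Proof.
move=> Zinf; apply: contrapT => noZ; apply: Zinf.
apply: sub_finite_set (finite_II n) => m Zm /=; rewrite ltnNge.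
by apply/negP => nm; apply: noZ; exists m.
Qed.

Lemma infinite_enumeration (Z : set nat) : infinite_set Z ->
  exists f : nat -> nat,
    [/\ increasing_seq f, injective f & forall n, Z (f n)].
Proof.
move=> Zinf.
have [|f [fincr _ fZ]] := @infinite_increasing_seq_wf _ nat Z _ Zinf 0%N.
  by move=> n; apply: sub_finite_set (finite_II n.+1) => m /=.
by exists f; split=> //; exact: increasing_seq_injective.
Qed.

Lemma cofinal_infinite (Z : set nat) :
  (forall n, exists2 m, Z m & (n <= m)%N) -> infinite_set Z.
Proof.
move=> Zcof /finite_seqP[X ZX].
have [m Zm] := Zcof (\max_(i <- X) i).+1; rewrite ltnNge => /negP; apply.
by apply: (@leq_bigmax_seq _ X predT id) => //; move: Zm; rewrite ZX.
Qed.

(** * Laminar families *)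

(** Suppose that every infinite subset of [Z] is split by a member of [V].  Let
    [U_ n] split [Y_ n], put [Y_ n.+1 := Y_ n `&` U_ n], and pick [q n] in [Y_ n]
    outside of [U_ n].  Then each [W] in [V] decides the range of [q]: it contains
    almost all [q n] if it contains some [U_ n], finitely many if it misses some
    [U_ n], and none if it lies in all [U_ n]. *)
Lemma laminar_decided (V : set (set nat)) (Z : set nat) :
    (forall U W, V U -> V W -> [\/ U `<=` W, W `<=` U | U `&` W = set0]) ->
    infinite_set Z ->
  exists Q, [/\ infinite_set Q, Q `<=` Z & forall U, V U -> decides Q U].
Proof.
move=> lam Zinf; apply: contrapT => noQ.
have split_ Y : infinite_set Y -> Y `<=` Z ->
    exists U, [/\ V U, infinite_set (Y `&` U) & infinite_set (Y `\` U)].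
  move=> Yinf YZ; apply: contrapT => nosplit; apply: noQ; exists Y; split=> //.
  move=> U VU; apply: contrapT => /not_orP[YU YU'].
  by apply: nosplit; exists U.
pose T := {Y : set nat | infinite_set Y /\ Y `<=` Z}.
have [next nextP] : {next : T -> set nat & forall Y : T, [/\ V (next Y),
    infinite_set (sval Y `&` next Y) & infinite_set (sval Y `\` next Y)]}.
  apply: (@choice _ _ (fun (Y : T) U => [/\ V U, infinite_set (sval Y `&` U) &
    infinite_set (sval Y `\` U)])) => -[Y [Yinf YZ]]; exact: split_.
have stepP (Y : T) :
    infinite_set (sval Y `&` next Y) /\ sval Y `&` next Y `<=` Z.
  split; first by have [] := nextP Y.
  by apply: subset_trans (svalP Y).2; exact: subIsetl.
pose step (Y : T) : T := exist _ _ (stepP Y).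
pose Y_ n := iter n step (exist _ Z (conj Zinf (@subset_refl _ Z))).
pose U_ n := next (Y_ n).
have Y_S n : sval (Y_ n.+1) = sval (Y_ n) `&` U_ n by [].
have Y_dec m n : (m <= n)%N -> sval (Y_ n) `<=` sval (Y_ m).
  elim: n => [|n IH]; first by rewrite leqn0 => /eqP->.
  rewrite leq_eqVlt => /predU1P[->//|]; rewrite ltnS => /IH.
  by apply: subset_trans; rewrite Y_S; exact: subIsetl.
have Y_U m n : (m < n)%N -> sval (Y_ n) `<=` U_ m.
  move=> /Y_dec mn; apply: subset_trans mn _; rewrite Y_S; exact: subIsetr.
have VU n : V (U_ n) by have [] := nextP (Y_ n).
have [q qP] : {q : nat -> nat &
    forall n, (sval (Y_ n) `\` U_ n) (q n) /\ (n <= q n)%N}.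
  apply: (@choice _ _ (fun n k => (sval (Y_ n) `\` U_ n) k /\ (n <= k)%N)) => n.
  have [_ _ /(@infinite_cofinal _ n)[k]] := nextP (Y_ n).
  by exists k.
have finI m : finite_set (q @` `I_m) by apply: finite_image; exact: finite_II.
apply: noQ; exists (range q); split.
- by apply: cofinal_infinite => n; exists (q n); [exists n|have [] := qP n].
- by move=> _ [n _ <-]; have [[+ _] _] := qP n; exact: (svalP (Y_ n)).2.
move=> W VW.
have [[n UW]|nsub] := pselect (exists n, U_ n `<=` W).
  left; apply: sub_finite_set (finI n.+1) => _ [[m _ <-] nW].
  exists m => //=; rewrite ltnNge; apply/negP => nm; apply/nW/UW.
  by have [[+ _] _] := qP m; exact: Y_U.
right.
have [[n UW]|nemp] := pselect (exists n, U_ n `&` W = set0).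
  apply: sub_finite_set (finI n.+1) => _ [[m _ <-] Wm].
  exists m => //=; rewrite ltnNge; apply/negP => nm.
  suff : (U_ n `&` W) (q m) by rewrite UW.
  by split=> //; have [[+ _] _] := qP m; exact: Y_U.
apply: sub_finite_set (@finite_set0 nat) => _ [[n _ <-] Wn].
have [[_ +] _] := qP n; apply.
have [UW|WU|UW] := lam _ _ (VU n) VW; last 2 first.
- exact: WU.
- by case: nemp; exists n.
by case: nsub; exists n.
Qed.

(** * The space of traces of a family of sets of integers *)

Section TraceSpace.
Variables (N : choiceType) (A : N -> set nat).

Definition cube := prod_topology (fun _ : N => bool).

Definition trace (U : set (set nat)) : cube := fun c => `[< U (A c) >].

Definition point_trace (n : nat) : cube := fun c => `[< A c n >].

Definition trace_space : topologicalType :=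
  set_type (closure (range point_trace)).

Lemma nbhs_cube_coord (x : cube) c : nbhs x [set y : cube | y c = x c].
Proof.
have := @proj_continuous N (fun=> bool) c x [set x c].
by apply; rewrite nbhs_principalE; apply/principal_filterP.
Qed.

Lemma cvg_cubeP (F : set_system cube) (x : cube) : Filter F ->
  (forall c, F [set y | y c = x c]) -> F --> x.
Proof.
move=> FF Fx; apply/cvg_sup => c P [_ [[V oV <-] Vxc]] /= VP.
by apply: filterS (Fx c) => y /= yx; apply: VP => /=; rewrite yx.
Qed.

(** [U] plays the role of an ultrafilter: the points of the space are the traces
    of the ultrafilters on [nat]. *)
Lemma trace_in_closure U :
  ProperFilter U -> (forall c, U (A c) \/ U (~` A c)) ->
  closure (range point_trace) (trace U).
Proof.
move=> PU Udec B; have : point_trace @ U --> trace U.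
  apply: cvg_cubeP => c; rewrite /trace /point_trace /=.
  change (U [set n | `[< A c n >] = `[< U (A c) >]]).
  have [Uc|Uc] := Udec c.
    rewrite (asboolT Uc).
    by apply: filterS Uc => n An /=; exact: asboolT.
  rewrite [`[< U _ >]]asboolF => [|UA].
    by apply: filterS Uc => n An /=; exact: asboolF.
  have [n []] : (A c `&` ~` A c) !=set0.
    by apply: (@filter_ex _ U); exact: filterI.
  by [].
move=> /(_ B) + xB => /(_ xB) UB.
have [n Bn] : (point_trace @^-1` B) !=set0 by exact: (@filter_ex _ U).
by exists (point_trace n); split => //; exists n.
Qed.

Lemma trace_space_hausdorff : hausdorff_space trace_space.
Proof.
have Hcube : hausdorff_space cube.
  apply: (@hausdorff_product N (fun=> bool)) => _; exact: discrete_hausdorff.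
rewrite open_hausdorff => x y xy.
have vxy : set_val x != set_val y by apply: contra_neq xy; exact: val_inj.
move: Hcube; rewrite open_hausdorff.
move=> /(_ _ _ vxy)[[U V] /= [xU yV] [oU oV UV]].
exists (set_val @^-1` U, set_val @^-1` V) => /=.
  by split; apply/mem_set => /=; exact: set_mem.
split; [by exists U|by exists V|].
apply/eqP; rewrite -subset0 => z [/= Uz Vz].
have : (U `&` V) (set_val z) by [].
by rewrite (eqP UV).
Qed.

Lemma trace_space_separable : separable_space trace_space.
Proof.
have pc n : closure (range point_trace) (point_trace n).
  by apply: subset_closure; exists n.
exists (range (fun n => SigSub (mem_set (pc n)) : trace_space)).
  exact: (card_le_trans (card_image_le _ _) (card_lexx _)).
move=> O [x Ox] [B oB BO].
have [|_ [[n _ <-] Bn]] := set_mem (svalP x) B.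
  apply: open_nbhs_nbhs; split => //; by move: Ox; rewrite -BO.
by exists (SigSub (mem_set (pc n))); split; [rewrite -BO|exists n].
Qed.


(** Finitely many points of the range can be excluded from a neighbourhood of
    [x], by one coordinate each, so relations that hold between the [A c] up to
    finite sets become exact relations between the coordinates of [x]. *)
Lemma nbhs_remainder_infinite (x : cube) (B : set cube) :
    closure (range point_trace) x -> ~ range point_trace x -> nbhs x B ->
  infinite_set [set n | B (point_trace n)].
Proof.
move=> clx nx xB /finite_fsetP[F BF].
have /choice[c cP] n : exists c, point_trace n c != x c.
  apply: contrapT => /forallNP nc; apply: nx; exists n => //.
  by apply/funext => d; apply/eqP/negPn/negP/nc.
have [|_ [[n _ <-] [Bn]]] := clx
    (B `&` \bigcap_(n in [set n | B (point_trace n)])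
             [set y | y (c n) = x (c n)]).
  apply: filterI => //; rewrite BF; apply: filter_bigI => n _.
  exact: nbhs_cube_coord.
by move=> /(_ n Bn)/= /eqP; rewrite (negPf (cP n)).
Qed.

Lemma remainder_le x c d :
    closure (range point_trace) x -> ~ range point_trace x ->
  A c <=* A d -> x c -> x d.
Proof.
move=> clx nx cd xc; apply: contrapT => /negP/negPf xd.
apply: (sub_infinite_set _ _ cd); last first.
  apply: (nbhs_remainder_infinite clx nx).
  exact: filterI (nbhs_cube_coord x c) (nbhs_cube_coord x d).
by move=> n [/=]; rewrite /point_trace xc xd => /asboolP ? /asboolP.
Qed.

Lemma remainder_disjoint x c d :
    closure (range point_trace) x -> ~ range point_trace x ->
  finite_set (A c `&` A d) -> ~ (x c /\ x d).
Proof.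
move=> clx nx cd [xc xd]; apply: (sub_infinite_set _ _ cd); last first.
  apply: (nbhs_remainder_infinite clx nx).
  exact: filterI (nbhs_cube_coord x c) (nbhs_cube_coord x d).
by move=> n [/=]; rewrite /point_trace xc xd => /asboolP ? /asboolP.
Qed.

Hypothesis laminarA :
  forall c d, [\/ A c <=* A d, A d <=* A c | finite_set (A c `&` A d)].

Hypothesis decidedA : forall Z, infinite_set Z ->
  exists Q, [/\ infinite_set Q, Q `<=` Z & forall c, decides Q (A c)].

(** Either infinitely many terms are traces of integers, and [decidedA] applies
    to the set of these integers unless one of them repeats infinitely often, or
    almost all terms lie in the remainder, where the coordinates form a laminar
    family of sets of indices. *)
Lemma sequence_decided (x : nat -> cube) :
    (forall n, closure (range point_trace) (x n)) ->
  exists Q, infinite_set Q /\ forall c, decides Q [set n | x n c].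
Proof.
move=> clx; pose S := [set n | range point_trace (x n)].
have [Sfin|Sinf] := pselect (finite_set S); last first.
  have /choice[m mP] n : exists k, S n -> point_trace k = x n.
    by have [[k _ kx]|nS] := pselect (S n); [exists k|exists 0%N].
  (* a constant subsequence, or a finite-to-one map [m] *)
  have [[k kinf]|fibfin] :=
      pselect (exists k, infinite_set (S `&` m @^-1` [set k])).
    exists (S `&` m @^-1` [set k]); split=> // c.
    have [Ack|nAck] := pselect (A c k); [left|right].
      apply: almost_sub_sub => n [/mP + /= mn].
      by rewrite mn => <-; exact: asboolT.
    apply: sub_finite_set (@finite_set0 nat) => n [[/mP + /= mn]].
    by rewrite mn => <- /asboolP.
  have {}fibfin F : finite_set F -> finite_set (S `&` m @^-1` F).
    move=> Ffin; have : finite_set (\bigcup_(k in F) (S `&` m @^-1` [set k])).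
      apply: bigcup_finite => // k _; apply: contrapT => kinf.
      by apply: fibfin; exists k.
    by apply: sub_finite_set => n [Sn Fmn]; exists (m n).
  have [|P [Pinf PmS Pdec]] := @decidedA (m @` S).
    move=> /fibfin; apply: sub_infinite_set Sinf => n Sn.
    by split=> //; exists n.
  exists (S `&` m @^-1` P); split=> [Qfin|c].
    apply: Pinf; apply: sub_finite_set (finite_image m Qfin) => k Pk.
    by have [n Sn nk] := PmS _ Pk; exists n => //; split; rewrite //= nk.
  have [Pc|Pc] := Pdec c; [left|right]; apply: sub_finite_set (fibfin _ Pc).
    move=> n [[Sn Pn] /= xn]; split=> //; split=> // Amn; apply: xn.
    by rewrite -(mP _ Sn); exact: asboolT.
  by move=> n [[Sn Pn] /=]; rewrite -(mP _ Sn) => /asboolP.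
pose V := range (fun c => [set n | x n c] `&` ~` S).
have [||Q [Qinf QS QV]] := @laminar_decided V (~` S).
- move=> _ _ [c _ <-] [d _ <-]; have [cd|dc|cd] := laminarA c d.
  + by apply: Or31 => n [xn Sn]; split=> //=; exact: remainder_le cd xn.
  + by apply: Or32 => n [xn Sn]; split=> //=; exact: remainder_le dc xn.
  + apply: Or33; rewrite -subset0 => n [[xn Sn] [xn' _]].
    exact: (remainder_disjoint (clx n) Sn cd).
- by rewrite -(setTD S); apply: infinite_setD => //; exact: infinite_nat.
exists Q; split=> // c.
have [|Qc|Qc] := QV ([set n | x n c] `&` ~` S); first by exists c.
  by left; apply: almost_sub_trans Qc _; apply: almost_sub_sub => n [].
right; apply: sub_finite_set Qc => n [Qn xn]; split=> //; split=> //.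
exact: QS.
Qed.

Lemma trace_space_sequentially_compact : sequentially_compact trace_space.
Proof.
move=> u; pose x n : cube := set_val (u n).
have clx n : closure (range point_trace) (x n) by exact: set_mem (svalP (u n)).
have [Q [Qinf Qdec]] := sequence_decided clx.
have [f [fincr finj fQ]] := infinite_enumeration Qinf.
exists f => //.
pose l : cube := fun c => `[< Q <=* [set n | x n c] >].
have evt P : finite_set (Q `\` P) -> \forall n \near \oo, P (f n).
  move=> QP; suff /finite_seqP[s sE] : finite_set [set n | ~ P (f n)].
    exists (\max_(i <- s) i).+1 => // n /= sn; apply: contrapT => nP.
    have ns : [set` s] n by rewrite -sE.
    by have := @leq_bigmax_seq _ s predT id n ns isT; rewrite leqNgt sn.
  apply: contrapT => inf; apply: inf.
  have : finite_set (f @` [set n | ~ P (f n)]).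
    by apply: sub_finite_set QP => _ [n nP <-].
  apply: card_le_finite; rewrite (card_le_eqr (inj_card_eq _))//.
  by move=> ? ? _ _ /finj.
have cvx : x \o f @ \oo --> l.
  apply: cvg_cubeP => c; apply: (evt [set n | x n c = l c]).
  rewrite /l; case: asboolP => [//|nQ].
  have [//|] := Qdec c.
  apply: sub_finite_set => n [Qn /= xn]; split=> //=.
  by case: (x n c) xn.
have cll : closure (range point_trace) l.
  apply: closed_closure.
move=> B lB; have [n xB] := @filter_ex _ \oo _ _ (cvx B lB).
exists (x (f n)); split; last exact: xB.
exact: clx.
exists (SigSub (mem_set cll)) => B [_ [[O oO <-] Ol] OB].
apply: (@filterS _ \oo _ ((x \o f) @^-1` O)) => [n On|]; first exact: OB.
exact: cvx (open_nbhs_nbhs (conj oO Ol)).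
Qed.
End TraceSpace.

(** * Well-orders and choices along them *)

Section WellFoundedChoice.
Variables (I : Type) (lt : I -> I -> Prop).
Hypothesis lt_wf : well_founded lt.

(** Transfinite recursion in which the value at [i] is not computed but chosen,
    subject to a relation with the earlier values that can always be met. *)
Lemma wf_recursive_choice (B : Type) (b0 : B) (R : I -> (I -> B) -> B -> Prop) :
    (forall i h h' b,
      (forall j, lt j i -> h j = h' j) -> R i h b -> R i h' b) ->
    (forall i h, (forall j, lt j i -> R j h (h j)) -> exists b, R i h b) ->
  exists h, forall i, R i h (h i).
Proof.
move=> Rext Rex.
pose glue i (rec : forall j, lt j i -> B) j :=
  if pselect (lt j i) is left ji then rec j ji else b0.
pose F i (rec : forall j, lt j i -> B) : B :=
  if pselect (exists b, R i (glue i rec) b) is left ex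
  then projT1 (cid ex) else b0.
have Fext i (r r' : forall j, lt j i -> B) :
    (forall j ji, r j ji = r' j ji) -> F i r = F i r'.
  move=> rr'; suff -> : r = r' by [].
  by apply: functional_extensionality_dep => j; apply/funext => ji; exact: rr'.
pose h := Fix lt_wf (fun=> B) F.
have hE i : h i = F i (fun j _ => h j) by exact: Fix_eq.
exists h; elim/(well_founded_ind lt_wf) => i IH.
(* [glue] extends the restriction of [h] by junk, which [Rext] ignores *)
have agree j : lt j i -> glue i (fun j _ => h j) j = h j.
  by rewrite /glue; case: pselect.
rewrite hE /F; case: pselect => [ex|[]].
  case: cid => /= b; apply: Rext; exact: agree.
have [b Rb] := Rex _ _ IH; exists b; apply: Rext Rb => j ji.
by rewrite agree.
Qed.

End WellFoundedChoice.

(** With [Big] expressing that a set has at least a given cardinality, this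
    provides initial ordinals without ordinals: the type [I] is large and its
    proper initial segments are small. *)
Lemma least_initial_segment (T : Type) (Big : set T -> Prop) (D : set T) :
    Big D ->
  exists (I : Type) (lt : I -> I -> Prop) (v : I -> T),
    [/\ well_founded lt, forall i j k, lt i j -> lt j k -> lt i k &
        forall i j, [\/ lt i j, i = j | lt j i]] /\
    [/\ injective v, range v `<=` D, Big (range v) &
        forall i, ~ Big (v @` [set j | lt j i])].
Proof.
move=> BigD.
have [R Rwo] := wochoice.well_ordering_principle {classic T}.
pose lt0 (x y : T) := ~ R y x.
have Rmin (A : set T) : A !=set0 -> exists2 z, A z & forall x, A x -> R z x.
  move=> [a Aa]; have [|z [[zA zmin] _]] := Rwo (fun x => `[< A x >]).
    by exists a; exact: asboolT.
  exists z; first exact: asboolW.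
  by move=> x Ax; apply: zmin; exact: asboolT.
have Rtot x y : R x y \/ R y x.
  have [|z [->|->] zmin] := Rmin [set x; y]; first by exists x; left.
    by left; apply: zmin; right.
  by right; apply: zmin; left.
have Ranti x y : R x y -> R y x -> x = y.
  move=> xy yx; have [|z [_ zu]] := Rwo (fun t => `[< t = x \/ t = y >]).
    by exists x; apply: asboolT; left.
  transitivity z; [symmetry|]; apply: zu; split.
  - by apply: asboolT; left.
  - by move=> t /asboolW[->|->] //; have [] := Rtot x x.
  - by apply: asboolT; right.
  - by move=> t /asboolW[->|->] //; have [] := Rtot y y.
have Rtrans x y z : R x y -> R y z -> R x z.
  move=> xy yz; have [|w wA wmin] := Rmin [set t | [\/ t = x, t = y | t = z]].
    by exists x; exact: Or31.
  have [xw yw zw] : [/\ R w x, R w y & R w z].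
    by split; apply: wmin; [exact: Or31|exact: Or32|exact: Or33].
  case: wA => wE; subst w => //.
    by rewrite (Ranti _ _ xy xw).
  by rewrite -(Ranti _ _ yz yw).
have lt0_wf : well_founded lt0.
  move=> x; apply: contrapT => nAcc.
  have [|z nz zmin] := Rmin [set t | ~ Acc lt0 t]; first by exists x.
  apply: nz; constructor => y yz; apply: contrapT => /zmin; exact: yz.
have lt0_trans x y z : lt0 x y -> lt0 y z -> lt0 x z.
  move=> xy yz zx; have [xy'|//] := Rtot x y.
  exact/yz/(Rtrans _ _ _ zx).
have lt0_tri x y : [\/ lt0 x y, x = y | lt0 y x].
  have [yx|] := pselect (R y x); last by move=> ?; exact: Or31.
  have [xy|] := pselect (R x y); last by move=> ?; exact: Or33.
  by apply: Or32; exact: Ranti.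
have [E [ED BigE Emin]] : exists E : set T, [/\ E `<=` D, Big E &
    forall x, E x -> ~ Big (E `&` lt0^~ x)].
  have [ex|nex] := pselect (exists x, D x /\ Big (D `&` lt0^~ x)); last first.
    by exists D; split=> // x Dx Bx; apply: nex; exists x.
  have [x [Dx Bx] xmin] := Rmin _ ex.
  exists (D `&` lt0^~ x); split=> [y []||y [Dy yx] By] //.
  apply: (yx); apply: xmin; split=> //.
  suff <- : D `&` lt0^~ x `&` lt0^~ y = D `&` lt0^~ y by [].
  apply/seteqP; split=> [z [[]]//|z [Dz zy]]; split=> //; split=> //.
  exact: lt0_trans yx.
exists {x | E x}, (fun i j => lt0 (sval i) (sval j)), sval; split; split.
- move=> i; move: {2}(sval i) (erefl (sval i)) => x.
  elim/(well_founded_ind lt0_wf): x i => x IH i ix; constructor => j ji.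
  by apply: (IH (sval j)) => //; rewrite -ix.
- by move=> i j k; exact: lt0_trans.
- move=> [i Ei] [j Ej]; have [ij|ij|ij] := lt0_tri i j;
    [exact: Or31| |exact: Or33].
  by apply: Or32; subst j; congr exist; exact: Prop_irrelevance.
- by move=> [i Ei] [j Ej] /= ij; subst j; congr exist; exact: Prop_irrelevance.
- by move=> _ [[i Ei] _ <-]; exact: ED.
- suff -> : range (@sval T E) = E by [].
  apply/seteqP; split=> [_ [[i Ei] _ <-]//|x Ex].
  by exists (exist _ x Ex).
- move=> [i Ei]; suff -> : sval @` [set j : {x | E x} | lt0 (sval j) i] =
      E `&` lt0^~ i by exact: Emin.
  apply/seteqP; split=> [_ [[j Ej] /= ? <-]//|x [Ex xi]].
  by exists (exist _ x Ex).
Qed.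

Lemma card_le_injectiveP (S T : Type) (B : set T) :
  [set: S] #<= B <-> exists2 e : S -> T, injective e & forall s, B (e s).
Proof.
split=> [/card_leP[f]|[e einj eB]].
  exists (fun s => set_val (f (to_setT s))) => [s s' /val_inj ff|s].
    have /(congr1 val)// : to_setT s = to_setT s'.
    by apply: 'inj_f ff; rewrite inE.
  exact: set_mem (valP (f (to_setT s))).
rewrite -(card_le_eql (inj_card_eq (fun x y _ _ => einj x y))).
by apply: subset_card_le => _ [s _ <-].
Qed.

(** Sets that are at least as large as the index type have an injective choice
    function: along a well-order of [S] with small initial segments, the values
    already used never exhaust the next set. *)
Lemma injective_choice (S B : Type) (b0 : B) (F : set S) (D : S -> set B) :
    (forall s, F s -> [set: S] #<= D s) ->
  exists t : S -> B, (forall s, F s -> D s (t s)) /\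
    (forall s s', F s -> F s' -> t s = t s' -> s = s').
Proof.
move=> FD.
have [J [lt [v [[lt_wf _ lt_tri] [vinj _ Jbig Jsmall]]]]] :=
  @least_initial_segment S (fun E => [set: S] #<= E) setT (card_lexx _).
have [e einj _] : exists2 e : S -> J, injective e & forall s, [set: J] (e s).
  apply/card_le_injectiveP; apply: card_le_trans Jbig _.
  exact: card_image_le.
pose R (j : J) (h : J -> B) b :=
  forall s, e s = j -> F s -> D s b /\ forall k, lt k j -> b <> h k.
have [|j h _|h hP] := wf_recursive_choice lt_wf b0 (R := R).
- move=> j h h' b hh' Rb s sj Fs; have [Db bh] := Rb s sj Fs.
  by split=> // k kj; rewrite -hh' //; exact: bh.
- have [[s [sj Fs]]|nos] := pselect (exists s, e s = j /\ F s); last first.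
    by exists b0 => s sj Fs; case: nos; exists s.
  have [b Db bh] : exists2 b, D s b & forall k, lt k j -> b <> h k.
    apply: contrapT => nob; apply: (Jsmall j).
    rewrite (card_le_eqr (inj_card_eq (fun x y _ _ => vinj x y))).
    apply: card_le_trans (FD _ Fs) (card_le_trans _ (card_image_le h _)).
    apply: subset_card_le => b Db; apply: contrapT => nb; apply: nob.
    by exists b => // k kj bk; apply: nb; exists k.
  by exists b => s' s'j _; have -> : s' = s by apply: einj; rewrite sj.
exists (h \o e); split=> [s Fs|s s' Fs Fs' /= hss'].
  by have [] := hP _ s erefl Fs.
apply: einj; have [ss'|//|s's] := lt_tri (e s) (e s').
  by have [_ /(_ _ ss')] := hP _ s' erefl Fs'; rewrite hss'.
by have [_ /(_ _ s's)] := hP _ s erefl Fs; rewrite hss'.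
Qed.

(** * Pseudointersections *)

(** The first two thirds become the successors of a stem in the tree; the last
    third stays outside of every node above the stem. *)
Lemma infinite_pieces (S : set nat) : exists h : bool -> set nat,
  infinite_set S -> [/\ forall b, infinite_set (h b), forall b, h b `<=` S,
    h true `&` h false = set0 & infinite_set (S `\` (h true `|` h false))].
Proof.
have [Sfin|Sinf] := pselect (finite_set S); first by exists (fun=> set0).
have [f [_ finj fS]] := infinite_enumeration Sinf.
have rinf k : (k < 3)%N -> infinite_set (range (fun n => f (n * 3 + k)%N)).
  move=> k3 rfin; apply: infinite_nat; apply: card_le_finite rfin.
  rewrite (card_le_eqr (inj_card_eq _))// => m n _ _ /finj/addIn/eqP.
  by rewrite eqn_mul2r => /eqP.
have rdisj k l m n : (k < 3)%N -> (l < 3)%N ->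
    f (m * 3 + k)%N = f (n * 3 + l)%N -> k = l.
  by move=> k3 l3 /finj/(congr1 (modn^~ 3)); rewrite !modnMDl !modn_small.
exists (fun b : bool => range (fun n => f (n * 3 + b)%N)) => _; split.
- by case; exact: rinf.
- by move=> b _ [n _ <-]; exact: fS.
- by rewrite -subset0 => _ [[m _ <-] [n _ /(rdisj 0 1 _ _ isT isT)]].
apply: sub_infinite_set (rinf 2 isT) => _ [n _ <-]; split; first exact: fS.
case=> -[m _]; first by move=> /(rdisj 1 2 _ _ isT isT).
by move=> /(rdisj 0 2 _ _ isT isT).
Qed.

(** A finite subfamily of a chain has an almost least member, so a chain of
    infinite sets has the strong finite intersection property; this one has too
    few members to lack a pseudointersection. *)
Lemma chain_pseudointersection (J : Type) (K : set J) (h : J -> set nat) X :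
    ~ (pseudointersection_number #<= K) -> infinite_set X ->
    (forall j, K j -> infinite_set (X `&` h j)) ->
    (forall j k, K j -> K k -> h j <=* h k \/ h k <=* h j) ->
  exists Q, [/\ infinite_set Q, Q `<=` X & forall j, K j -> Q <=* h j].
Proof.
move=> Ksmall Xinf Xh htot.
have [[j0 Kj0]|K0] := pselect (K !=set0); last first.
  by exists X; split=> // j Kj; case: K0; exists j.
pose F := (fun j => X `&` h j) @` K.
have below (s : seq (set nat)) : [set` s] `<=` F ->
    exists2 j, K j & X `&` h j <=* \bigcap_(B in [set` s]) B.
  elim: s => [|B s IH] sF.
    by exists j0 => //; apply: almost_sub_sub => n _ B /=; rewrite in_nil.
  have [C Cs|j Kj js] := IH.
    by apply: sF; rewrite /= in_cons; move: Cs => /= ->; rewrite orbT.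
  have [k Kk kB] : F B by apply: sF; rewrite /= in_cons eqxx.
  suff [l Kl [lj lk]] : exists2 l, K l & h l <=* h j /\ h l <=* h k.
    exists l => //; have : X `&` h l <=* (\bigcap_(C in [set` s]) C) `&` B.
      rewrite -kB; apply: almost_subI.
        apply: almost_sub_trans js; apply: almost_subI; last first.
          by apply: almost_sub_trans lj; apply: almost_sub_sub => n [].
        by apply: almost_sub_sub => n [].
      apply: almost_subI; last first.
        by apply: almost_sub_trans lk; apply: almost_sub_sub => n [].
      by apply: almost_sub_sub => n [].
    move=> /almost_sub_trans; apply; apply: almost_sub_sub => n [ns nB] C /=.
    by rewrite in_cons => /predU1P[->//|]; exact: ns.
  have refl i : h i <=* h i by apply: almost_sub_sub.
  by have [jk|kj] := htot _ _ Kj Kk; [exists j|exists k].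
have : ~ pseudointersection_free F.
  move=> /pseudointersection_number_le pF; apply: Ksmall.
  exact: card_le_trans pF (card_image_le _ _).
move=> nfree.
have [P [Pinf PF]] : exists P, pseudointersection F P.
  apply: contrapT => nP; apply: nfree; split=> //.
    by move=> _ [j Kj <-]; exact: Xh.
  move=> G GF /finite_seqP[s sG]; rewrite sG in GF *.
  have [j Kj js] := below _ GF.
  by apply: sub_infinite_set (almost_sub_infinite js (Xh _ Kj)) => n [].
exists (P `&` X); split.
- apply: almost_sub_infinite Pinf; apply: (@almost_sub_trans (X `&` h j0)).
    by apply: PF; exists j0.
  by apply: almost_sub_sub => n [].
- by move=> n [].
move=> j Kj; apply: (@almost_sub_trans (X `&` h j)); last first.
  by apply: almost_sub_sub => n [].
apply: (@almost_sub_trans P); first by apply: almost_sub_sub => n [].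
by apply: PF; exists j.
Qed.

Lemma decreasing_pseudointersection (Z : nat -> set nat) :
    (forall n, Z n.+1 `<=` Z n) -> (forall n, infinite_set (Z n)) ->
  exists Q, [/\ infinite_set Q, Q `<=` Z 0 & forall n, Q <=* Z n].
Proof.
move=> Zdec Zinf.
have Zle m n : (m <= n)%N -> Z n `<=` Z m.
  elim: n => [|n IH]; first by rewrite leqn0 => /eqP->.
  rewrite leq_eqVlt => /predU1P[->//|]; rewrite ltnS => /IH.
  exact: subset_trans.
have /choice[q qP] n : exists m, Z n m /\ (n <= m)%N.
  by have [m Zm nm] := infinite_cofinal n (Zinf n); exists m.
exists (range q); split=> [|_ [n _ <-]|n].
- by apply: cofinal_infinite => n; exists (q n); [exists n|have [] := qP n].
- by apply: (Zle 0 n) => //; have [] := qP n.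
apply: sub_finite_set (finite_image q (finite_II n)) => _ [[m _ <-] nZ].
exists m => //=; rewrite ltnNge; apply/negP => nm; apply: nZ.
by apply: Zle nm _ _; have [] := qP m.
Qed.

(** * The tree *)

Section Tree.
Variables (I : Type) (lt : I -> I -> Prop).
Hypothesis lt_wf : well_founded lt.
Hypothesis lt_trans : forall i j k, lt i j -> lt j k -> lt i k.
Hypothesis lt_tri : forall i j, [\/ lt i j, i = j | lt j i].
Hypothesis segment_small :
  forall i, ~ (pseudointersection_number #<= [set j | lt j i]).

Implicit Types (i j k : I) (f g t : I -> bool).

Definition agree i f g := forall j, lt j i -> f j = g j.

Definition restrict i f j := `[< lt j i >] && f j.

Lemma restrictP i f g : restrict i f = restrict i g <-> agree i f g.
Proof.
split=> [fg j ji|fg].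
  by have := congr1 (fun h => h j) fg; rewrite /restrict asboolT.
apply/funext => j; rewrite /restrict; case: asboolP => //= ji; exact: fg.
Qed.

Lemma agree_restrict i f : agree i f (restrict i f).
Proof. by move=> j ji; rewrite /restrict asboolT. Qed.

Lemma restrict_id i f : restrict i (restrict i f) = restrict i f.
Proof. by apply/restrictP => j ji; rewrite -agree_restrict. Qed.

Variable piece : set nat -> bool -> set nat.
Hypothesis pieceP : forall S, infinite_set S ->
  [/\ forall b, infinite_set (piece S b), forall b, piece S b `<=` S,
    piece S true `&` piece S false = set0 &
    infinite_set (S `\` (piece S true `|` piece S false))].

(** [Q i t] is a stem at level [i], indexed by the part of the branch [t] below
    [i]; the value [f i] then selects one of two disjoint pieces of the stem. *)
Definition node (Q : I -> (I -> bool) -> set nat) i f :=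
  piece (Q i (restrict i f)) (f i).

Lemma node_agree Q i f g : agree i f g -> f i = g i -> node Q i f = node Q i g.
Proof. by rewrite /node => /restrictP -> ->. Qed.

(** [e] embeds [2^omega] into the branches below [i] that meet [X]. *)
Definition thick Q i (X : set nat) := infinite_set X /\
  exists2 e : set nat -> I -> bool,
    (forall x y, agree i (e x) (e y) -> x = y) &
    forall x j, lt j i -> infinite_set (X `&` node Q j (e x)).

(** The last clause puts a stem inside every thick set.  The reserved piece of
    that stem will be a subset decided by all nodes. *)
Definition admissible i Q (q : (I -> bool) -> set nat) :=
  (forall t, infinite_set (q t) /\ forall j, lt j i -> q t <=* node Q j t) /\
  forall X, thick Q i X -> exists t, q (restrict i t) `<=` X.

(** At level [i] there are at most continuum many thick sets and each of them
    meets continuum many branches, so [injective_choice] assigns to each thick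
    set a branch of its own; the stem at that branch is a pseudointersection of
    the nodes below it, taken inside the assigned set. *)
Lemma tree_exists :
  exists Q : I -> (I -> bool) -> set nat, forall i, admissible i Q (Q i).
Proof.
apply: (wf_recursive_choice lt_wf (fun=> set0) (R := admissible))
  => [i h h' q hh'|i h IH].
  have nE j t : lt j i -> node h' j t = node h j t.
    by move=> ji; rewrite /node hh'.
  move=> [qh qX]; split=> [t|X [Xinf [e einj eX]]].
    have [qt qtj] := qh t; split=> // j ji; rewrite nE //; exact: qtj.
  by apply: qX; split=> //; exists e => // x j ji; rewrite -nE //; exact: eX.
have hinf j t : lt j i -> infinite_set (node h j t).
  move=> ji; have [/(_ (restrict j t))[hj _] _] := IH _ ji.
  by have [+ _ _ _] := pieceP hj; apply.
have hdec j k t : lt j k -> lt k i -> node h k t <=* node h j t.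
  move=> jk ki; have [/(_ (restrict k t))[hk hkj] _] := IH _ ki.
  apply: (@almost_sub_trans (h k (restrict k t))).
    by apply: almost_sub_sub; have [_ + _ _] := pieceP hk; apply.
  rewrite (@node_agree _ _ t (restrict k t)); first exact: hkj.
    move=> l lj; apply: agree_restrict; exact: lt_trans jk.
  exact: agree_restrict.
have pseudo X t : infinite_set X ->
    (forall j, lt j i -> infinite_set (X `&` node h j t)) ->
    exists q, [/\ infinite_set q, q `<=` X &
      forall j, lt j i -> q <=* node h j t].
  move=> Xinf Xh; apply: chain_pseudointersection => //.
    exact: segment_small.
  move=> j k /= ji ki; have [jk|->|kj] := lt_tri j k.
  - by right; exact: hdec.
  - by left; exact: almost_sub_sub.
  - by left; exact: hdec.
have resE j t : lt j i -> node h j (restrict i t) = node h j t.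
  move=> ji; symmetry; apply: node_agree; last exact: agree_restrict.
  move=> l lj; apply: agree_restrict; exact: lt_trans ji.
(* [c X] is the branch reserved for the thick set [X] *)
have [|c [cD cinj]] := @injective_choice (set nat) (I -> bool) (fun=> false)
    (thick h i) (fun X => [set t | restrict i t = t /\
      forall j, lt j i -> infinite_set (X `&` node h j t)]).
  move=> X [_ [e einj eX]]; apply/card_le_injectiveP.
  exists (fun x => restrict i (e x)) => [x y /restrictP/einj//|x].
  by split=> [|j ji]; [exact: restrict_id|rewrite resE //; exact: eX].
have /choice[q qP] t : exists q : set nat, [/\ infinite_set q,
    forall j, lt j i -> q <=* node h j t &
    forall X, thick h i X -> c X = t -> q `<=` X].
  have [[X [Xthick ct]]|nX] := pselect (exists X, thick h i X /\ c X = t).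
    have [_ Xt] := cD _ Xthick; rewrite ct in Xt.
    have [q [qinf qX qh]] := pseudo _ _ Xthick.1 Xt.
    exists q; split=> // Y Ythick cY.
    by rewrite (cinj _ _ Ythick Xthick) // cY.
  have [|q [qinf _ qh]] := @pseudo setT t infinite_nat.
    by move=> j ji; rewrite setTI; exact: hinf.
  by exists q; split=> // X Xthick ct; case: nX; exists X.
exists q; split=> [t|X Xthick]; first by have [] := qP t.
have [cX _] := cD _ Xthick; exists (c X); rewrite cX.
by have [_ _ +] := qP (c X); apply.
Qed.

Section NodeTheory.
Variable Q : I -> (I -> bool) -> set nat.
Hypothesis admissibleQ : forall i, admissible i Q (Q i).
Local Notation A := (node Q).

Let stem_infinite i t : infinite_set (Q i t).
Proof. by have [/(_ t)[]] := admissibleQ i. Qed.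

Lemma node_infinite i f : infinite_set (A i f).
Proof.
by have [+ _ _ _] := pieceP (@stem_infinite i (restrict i f)); apply.
Qed.

Lemma node_decr i j f : lt j i -> A i f <=* A j f.
Proof.
move=> ji; apply: (@almost_sub_trans (Q i (restrict i f))).
  apply: almost_sub_sub.
  by have [_ + _ _] := pieceP (@stem_infinite i (restrict i f)); apply.
rewrite (@node_agree _ j f (restrict i f)).
- by have [/(_ (restrict i f))[_ + _]] := admissibleQ i; apply.
- move=> l lj; apply: agree_restrict; exact: lt_trans ji.
- exact: agree_restrict.
Qed.

Definition le i j := lt i j \/ i = j.

Lemma node_decr_le i j f : le j i -> A i f <=* A j f.
Proof. by move=> [/node_decr//|->]; exact: almost_sub_sub. Qed.

Lemma node_disjoint i f g : agree i f g -> f i <> g i -> A i f `&` A i g = set0.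
Proof.
rewrite /node => /restrictP ->.
have [_ _ d _] := pieceP (@stem_infinite i (restrict i g)).
by case: (f i) (g i) => -[]// _; rewrite // setIC.
Qed.

Lemma node_almost_disjoint i j f g k :
  le k i -> le k j -> f k <> g k -> finite_set (A i f `&` A j g).
Proof.
elim/(well_founded_ind lt_wf): k => k IH ki kj fgk.
have [[l lk fgl]|nl] := pselect (exists2 l, lt l k & f l <> g l).
  apply: (IH l) => //; left.
    by case: ki => [|<-//]; exact: lt_trans.
  by case: kj => [|<-//]; exact: lt_trans.
have fg : agree k f g.
  by move=> l lk; apply: contrapT => fgl; apply: nl; exists l.
apply: almost_sub_meet (node_decr_le f ki) _; rewrite setIC.
apply: almost_sub_meet (node_decr_le g kj) _.
by rewrite setIC node_disjoint.
Qed.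

Lemma node_laminar i j f g :
  [\/ A i f <=* A j g, A j g <=* A i f | finite_set (A i f `&` A j g)].
Proof.
have [[k [ki kj fgk]]|nk] :=
    pselect (exists k, [/\ le k i, le k j & f k <> g k]).
  by apply: Or33; exact: node_almost_disjoint fgk.
have fg k : le k i -> le k j -> f k = g k.
  by move=> ki kj; apply: contrapT => fgk; apply: nk; exists k.
have [ij|eij|ji] := lt_tri i j.
- apply: Or32; rewrite (@node_agree _ i f g); first exact: node_decr.
    by move=> l li; apply: fg; left => //; exact: lt_trans ij.
  by apply: fg; [right|left].
- subst j; apply: Or31; rewrite (@node_agree _ i f g).
  + exact: almost_sub_sub.
  + by move=> l li; apply: fg; left.
  + by apply: fg; right.
- apply: Or31; rewrite (@node_agree _ j g f); first exact: node_decr.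
    by move=> l lj; rewrite fg //; left => //; exact: lt_trans ji.
  by rewrite fg //; [left|right].
Qed.

(** A set that follows a branch below level [i] and stops there is split
    nowhere: the nodes from level [i] on that follow this branch below [i] almost
    miss it, and nodes that leave the branch earlier are almost disjoint from a
    node that almost contains it. *)
Lemma dead_end_decides i f Z :
    (forall j, lt j i -> Z <=* A j f) ->
    (forall g, agree i f g -> finite_set (Z `&` A i g)) ->
  forall j g, decides Z (A j g).
Proof.
move=> Zbelow Zdead j g.
have differ k : lt k i -> le k j -> f k <> g k -> decides Z (A j g).
  move=> ki kj fgk; right; apply: almost_sub_meet (Zbelow _ ki) _.
  by apply: node_almost_disjoint fgk => //; right.
have [ji|ij] : lt j i \/ le i j.
  by have [|->|] := lt_tri i j; [right; left|right; right|left].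
  have [[k [kj fgk]]|nk] := pselect (exists k, le k j /\ f k <> g k).
    apply: differ (kj) (fgk); case: kj => [kj|->//]; exact: lt_trans ji.
  left; rewrite (@node_agree _ j g f); first exact: Zbelow.
    move=> k kj; apply: contrapT => gfk; apply: nk; exists k.
    by split; [left|exact: nesym].
  by apply: contrapT => gfj; apply: nk; exists j; split; [right|exact: nesym].
have [fg|/existsNP[k /not_implyP[ki fgk]]] := pselect (agree i f g); last first.
  apply: differ fgk => //.
  by left; case: ij => [|<-//]; exact: lt_trans.
right; rewrite setIC; apply: almost_sub_meet (node_decr_le g ij) _.
by rewrite setIC; exact: Zdead.
Qed.

(** * Every infinite set has a decided infinite subset *)

Definition undecidable Z := infinite_set Z /\ forall Y, Y `<=` Z ->
  infinite_set Y -> exists i f, ~ decides Y (A i f).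

Lemma undecidable_sub Y Z :
  Y `<=` Z -> infinite_set Y -> undecidable Z -> undecidable Y.
Proof.
move=> YZ Yinf [Zinf Zund]; split=> // W WY; apply: Zund.
exact: subset_trans YZ.
Qed.

(** Going up a branch chosen greedily, [Z] can only get stuck at a level [i] if
    some infinite subset of [Z] follows the branch below [i] and meets neither
    successor; [dead_end_decides] excludes this. *)
Lemma undecidable_path Z : undecidable Z ->
  exists f, forall j, infinite_set (Z `&` A j f).
Proof.
move=> [Zinf Zund].
apply: (wf_recursive_choice lt_wf false
  (R := fun j h b => infinite_set (Z `&` piece (Q j (restrict j h)) b))).
  by move=> i h h' b /restrictP ->.
move=> i h IH; apply: contrapT => /forallNP nb.
have [||||W [Winf WZ Wh]] :=
    @chain_pseudointersection I [set j | lt j i] (fun j => A j h) Z.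
- exact: segment_small.
- by [].
- exact: IH.
- move=> j k _ _; have [jk|->|kj] := lt_tri j k.
  + by right; exact: node_decr.
  + by left; exact: almost_sub_sub.
  + by left; exact: node_decr.
have [j [f []]] := Zund _ WZ Winf.
apply: (@dead_end_decides i h) => // g /restrictP hg.
have /contrapT := nb (g i); rewrite hg; apply: sub_finite_set.
exact: setSI.
Qed.

(** If a node [A i g] splits [Z], follow a path of the part of [Z] outside of
    this node: at level [i] it has left the branch [g]. *)
Lemma undecidable_split Z : undecidable Z -> exists i (br : bool -> I -> bool),
  (forall b, infinite_set (Z `&` A i (br b))) /\
  exists2 k, le k i & br true k <> br false k.
Proof.
move=> Zund; have [Zinf /(_ _ (@subset_refl _ Z) Zinf)[i [g]]] := Zund.
move=> /not_orP[ZDA ZA].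
have [|f fZ] := @undecidable_path (Z `\` A i g).
  by apply: undecidable_sub Zund => //; exact: subIsetl.
have Zf : infinite_set (Z `&` A i f).
  by apply: sub_infinite_set (fZ i); apply: setSI; exact: subDsetl.
exists i, (fun b => if b then f else g); split; first by case.
apply: contrapT => nk; have := fZ i.
rewrite (@node_agree _ i f g).
- by rewrite setDE -setIA setICl setI0; apply; exact: finite_set0.
- by move=> k ki; apply: contrapT => fgk; apply: nk; exists k => //; left.
- by apply: contrapT => fgi; apply: nk; exists i => //; right.
Qed.

Hypothesis lt_bounded : forall e : nat -> I, exists i, forall n, lt (e n) i.

(** Iterating [undecidable_split] along the finite binary sequences gives a
    Cantor scheme [Zs] whose splitting levels are bounded by some [i].  Each
    [x : set nat] yields a pseudointersection of the sets [Zs] along [x], which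
    is again undecidable, and [undecidable_path] prolongs its branch to all
    levels.  Two such branches separate, below [i], where the scheme does. *)
Lemma undecidable_thick X : undecidable X -> exists i, thick Q i X.
Proof.
move=> Xund.
have [i0 _] := undecidable_split Xund.
have /choice[c cP] Z : exists c : I * (bool -> I -> bool), undecidable Z ->
    (forall b, infinite_set (Z `&` A c.1 (c.2 b))) /\
    exists2 k, le k c.1 & c.2 true k <> c.2 false k.
  have [/undecidable_split[i [br brP]]|nZ] := pselect (undecidable Z).
    by exists (i, br).
  by exists (i0, fun=> fun=> false).
pose Zs := fix Zs (s : seq bool) : set nat :=
  if s is b :: s' then Zs s' `&` A (c (Zs s')).1 ((c (Zs s')).2 b) else X.
have Zs_und s : undecidable (Zs s).
  elim: s => [|b s IH]; first exact: Xund.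
  apply: (undecidable_sub _ _ IH); first exact: subIsetl.
  by have [+ _] := cP _ IH; apply.
have [i iP] := lt_bounded
  (fun n => (c (Zs (odflt [::] (choice.unpickle n)))).1).
have {}iP s : lt (c (Zs s)).1 i.
  by have := iP (choice.pickle s); rewrite choice.pickleK.
(* the first [n] bits of [x], the latest one in front *)
pose pre (x : set nat) := fix pre n : seq bool :=
  if n is m.+1 then `[< x m >] :: pre m else [::].
have /choice[e eP] (x : set nat) : exists g, exists W, [/\ W `<=` X,
    forall n, W <=* Zs (pre x n) & forall j, infinite_set (W `&` A j g)].
  have [n|n|W [Winf WX WZ]] :=
      @decreasing_pseudointersection (fun n => Zs (pre x n)).
  - exact: subIsetl.
  - by have [] := Zs_und (pre x n).
  have [|g gP] := @undecidable_path W; first exact: undecidable_sub Xund.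
  by exists g, W.
exists i; split; first exact: Xund.1.
exists e => [x y exy|x j _]; last first.
  have [W [WX _ +]] := eP x => /(_ j); apply: sub_infinite_set.
  exact: setSI.
have follow z n k : le k (c (Zs (pre z n))).1 ->
    e z k = (c (Zs (pre z n))).2 `[< z n >] k.
  move=> kl; apply: contrapT => ezk; have [W [_ WZ We]] := eP z.
  apply: (We (c (Zs (pre z n))).1).
  apply: almost_sub_meet (WZ n.+1) _ => /=.
  apply: (@almost_sub_meet _ (A (c (Zs (pre z n))).1
    ((c (Zs (pre z n))).2 `[< z n >]))).
    by apply: almost_sub_sub; exact: subIsetr.
  exact: (node_almost_disjoint kl kl (nesym ezk)).
have same n : pre x n = pre y n -> `[< x n >] = `[< y n >].
  move=> xyn; have [_ [k kl brk]] := cP _ (Zs_und (pre x n)).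
  have xk := follow x n k kl; have := follow y n k; rewrite -xyn => /(_ kl) yk.
  have : e x k = e y k.
    by apply: exy; case: kl => [|->]; [move=> /lt_trans; apply|]; exact: iP.
  by rewrite xk yk; case: `[< x n >] `[< y n >] => -[]// /esym.
have pre_eq n : pre x n = pre y n.
  by elim: n => [//|n IH] /=; rewrite IH same.
apply/seteqP; split=> n xn; apply/asboolP.
  by rewrite -same //; exact/asboolP.
by rewrite same //; exact/asboolP.
Qed.

(** [X] contains a stem; its piece outside of both successors is a dead end. *)
Lemma no_undecidable X : ~ undecidable X.
Proof.
move=> Xund; have [i /(admissibleQ i).2[t tX]] := undecidable_thick Xund.
have [_ Ssub _ Winf] := pieceP (@stem_infinite i (restrict i t)).
have [_ Xdec] := Xund.
set S := Q i (restrict i t) in tX Ssub Winf.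
have [|j [g []]] := Xdec _ _ Winf.
  by apply: subset_trans tX; exact: subDsetl.
apply: (@dead_end_decides i (restrict i t)) => [j' ji|h th].
  apply: (@almost_sub_trans S); first by apply: almost_sub_sub; exact: subDsetl.
  by have [/(_ (restrict i t))[_ + _]] := admissibleQ i; apply.
have hE : restrict i h = restrict i t.
  by rewrite -(restrict_id i t); apply/esym/restrictP.
rewrite /node hE -/S; apply: sub_finite_set (@finite_set0 nat) => n [[_ nS] hn].
by apply: nS; case: (h i) hn; [left|right].
Qed.

Lemma node_decided Z : infinite_set Z ->
  exists Y, [/\ infinite_set Y, Y `<=` Z & forall i f, decides Y (A i f)].
Proof.
move=> Zinf; apply: contrapT => nY; apply: (@no_undecidable Z); split=> // Y YZ.
move=> Yinf; apply: contrapT => Ydec; apply: nY; exists Y; split=> // i f.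
by apply: contrapT => nd; apply: Ydec; exists i, f.
Qed.

(** * Branches as points *)

Lemma path_ultrafilter (i0 : I) f : exists U : set_system nat,
  [/\ UltraFilter U, forall i, U (A i f) &
      forall B, finite_set B -> ~ U B].
Proof.
pose F := [set B | exists i, A i f <=* B].
have FF : ProperFilter F.
  split.
    move=> [i]; rewrite /almost_sub setD0; exact: node_infinite.
  split.
  - by exists i0; apply: almost_sub_sub.
  - move=> B C [i iB] [j jC].
    have [ij|eij|ji] := lt_tri i j.
    + exists j; apply: almost_subI => //; apply: almost_sub_trans iB.
      exact: node_decr.
    + by subst j; exists i; exact: almost_subI.
    + exists i; apply: almost_subI => //; apply: almost_sub_trans jC.
      exact: node_decr.
  - move=> B C BC [i iB]; exists i; apply: almost_sub_trans iB _.
    exact: almost_sub_sub.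
have [U [UU FU]] := ultraFilterLemma FF.
exists U; split=> // [i|B Bfin UB].
  by apply: FU; exists i; exact: almost_sub_sub.
have : U (B `&` ~` B).
  apply: filterI => //; apply: FU; exists i0.
  by rewrite /almost_sub setDE setCK; exact: finite_setIr.
rewrite setICr; exact: filter_not_empty.
Qed.

End NodeTheory.
End Tree.

(** * Cardinal arithmetic *)

Lemma power_set_card_le (T : Type) (U : pointedType) (A : set T) (B : set U) :
  A #<= B -> power_set A #<= power_set B.
Proof.
move=> /pcard_leP[f].
rewrite -(@card_le_eql _ _ _ _ _ _ (inj_card_eq (f := fun C => f @` C) _)).
  by apply: subset_card_le => _ [C CA <-] _ [x /CA Ax <-]; exact: funS.
have sub (C C' : set T) :
    C `<=` A -> C' `<=` A -> f @` C = f @` C' -> C `<=` C'.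
  move=> CA CA' CC' x Cx.
  have [y Cy] : (f @` C') (f x) by rewrite -CC'; exists x.
  move=> /('inj_f); rewrite !inE => yx; rewrite -yx //; [exact: CA'|exact: CA].
move=> C C'; rewrite !inE => CA CA' CC'; apply/seteqP.
by split; apply: sub.
Qed.

Lemma cantor_card (U : pointedType) (A : set U) : ~ (power_set A #<= A).
Proof.
move=> /pcard_leP[f].
pose D := [set x | exists C, [/\ C `<=` A, f C = x & ~ C x]].
have DA : D `<=` A by move=> x [C [CA <- _]]; exact: funS.
have nD : ~ D (f D).
  move=> /[dup] DfD [C [CA fC]]; apply.
  suff -> : C = D by [].
  by apply: ('inj_f) fC; rewrite inE.
by apply: (nD); exists D.
Qed.

(** A function on [I] is determined by its restrictions to the initial segments
    that end at the points [e n] of a cofinal sequence, each of which can be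
    coded by a set of integers; countably many such codes are again coded by one
    set of integers.  The code of the pair [(n, 0)] carries the value at [e n]
    itself. *)
Lemma countable_cofinality (I : Type) (lt : I -> I -> Prop) (v : I -> set nat)
    (e : nat -> I) :
    injective v ->
    (forall i j, [\/ lt i j, i = j | lt j i]) ->
    (forall i, power_set (v @` [set j | lt j i]) #<= [set: set nat]) ->
    (forall i, exists n, ~ lt (e n) i) ->
  exists phi : (I -> bool) -> set nat, injective phi.
Proof.
move=> vinj lt_tri vsmall ecof.
have /choice[psi psiP] i : exists psi : set (set nat) -> set nat,
    {in power_set (v @` [set j | lt j i]) &, injective psi}.
  exact/pcard_injP/vsmall.
pose code i (f : I -> bool) := psi i (v @` [set j | lt j i /\ f j]).
pose phi (f : I -> bool) : set nat := fun p : nat =>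
  match choice.unpickle p with
  | Some (n, 0) => f (e n)
  | Some (n, m.+1) => code (e n) f m
  | None => False end.
exists phi => f g fg.
have phiE h n m : phi h (choice.pickle (n, m)) =
    if m is m'.+1 then code (e n) h m' else h (e n).
  by rewrite /phi choice.pickleK.
have end_eq n : f (e n) = g (e n).
  have := phiE f n 0%N; rewrite fg phiE => gf.
  by apply/idP/idP; rewrite gf.
have code_eq n : code (e n) f = code (e n) g.
  apply/funext => m; have := phiE f n m.+1; rewrite fg phiE.
  by [].
have below n j : lt j (e n) -> f j = g j.
  have inS h : v @` [set j | lt j (e n) /\ h j] \in
      power_set (v @` [set j | lt j (e n)]).
    by rewrite inE => _ [k [kn _] <-]; exists k.
  have := psiP _ _ _ (inS f) (inS g) (code_eq n) => S_eq jn.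
  apply/idP/idP => hj.
    have : (v @` [set j | lt j (e n) /\ f j]) (v j) by exists j.
    by rewrite S_eq => -[k [_ gk] /vinj <-].
  have : (v @` [set j | lt j (e n) /\ g j]) (v j) by exists j.
  by rewrite -S_eq => -[k [_ gk] /vinj <-].
apply/funext => i; have [n nlt] := ecof i.
by have [/nlt[]|<-//|/below] := lt_tri (e n) i.
Qed.

(** * The space *)

(** The points given by two branches [f] and [g] that differ at [k] are
    separated by the coordinate [(k, f)]: the node [A (k, f)] is almost disjoint
    from [A (k, g)], so it is not in the nonprincipal ultrafilter of [g]. *)
Lemma sequentially_compact_separable_large :
  card_lt continuum (power_set pseudointersection_number) ->
  exists X : topologicalType,
     [/\ sequentially_compact X, separable_space X, hausdorff_space X &
         card_lt continuum [set: X]].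
Proof.
have -> : continuum = [set: set nat] by apply/seteqP.
move=> /andP[_ /negP pbig].
have [I [lt [v [[lt_wf lt_trans lt_tri] [vinj vp Ibig Ismall]]]]] :=
  @least_initial_segment (set nat)
    (fun E => ~ (power_set E #<= [set: set nat])) _ pbig.
have {}Ismall i : power_set (v @` [set j | lt j i]) #<= [set: set nat].
  by apply: contrapT; exact: Ismall.
have Ilarge : ~ exists phi : (I -> bool) -> set nat, injective phi.
  move=> [phi phiinj]; apply: Ibig; apply/pcard_injP.
  exists (fun B => phi (fun i => `[< B (v i) >])) => B C.
  rewrite !inE => Bv Cv /phiinj BC.
  have BCv i : B (v i) <-> C (v i).
    have BCi : `[< B (v i) >] = `[< C (v i) >] := congr1 (fun f => f i) BC.
    by split=> h; apply/asboolP; [rewrite -BCi|rewrite BCi]; apply/asboolP.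
  apply/seteqP; split=> x xB.
    by have [i _ iv] := Bv _ xB; rewrite -iv in xB *; exact/BCv.
  by have [i _ iv] := Cv _ xB; rewrite -iv in xB *; exact/BCv.
have segment_small i :
    ~ (pseudointersection_number #<= [set j | lt j i]).
  move=> pi; apply: pbig; apply: card_le_trans (Ismall i).
  apply: power_set_card_le.
  by rewrite (card_le_eqr (inj_card_eq (fun x y _ _ => @vinj x y))).
have lt_bounded (e : nat -> I) : exists i, forall n, lt (e n) i.
  apply: contrapT => /forallNP nb; apply: Ilarge.
  by apply: (countable_cofinality vinj lt_tri Ismall) => i; exact/existsNP.
have [i0 _] : exists i0 : I, True.
  apply: contrapT => /forallNP I0; apply: Ilarge.
  by exists (fun=> set0) => f g _; apply/funext => i; have := I0 i.
have [piece pieceP] := choice infinite_pieces.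
have [Q Qadm] := tree_exists lt_wf lt_trans lt_tri segment_small pieceP.
pose N : choiceType := {classic I * (I -> bool)}.
pose A (c : N) := node lt piece Q c.1 c.2.
have laminarA c d : [\/ A c <=* A d, A d <=* A c | finite_set (A c `&` A d)].
  exact: (node_laminar lt_wf lt_trans lt_tri pieceP Qadm).
have decidedA Z : infinite_set Z ->
    exists Y, [/\ infinite_set Y, Y `<=` Z & forall c, decides Y (A c)].
  move=> /(node_decided lt_wf lt_trans lt_tri segment_small pieceP Qadm
    lt_bounded).
  by move=> [Y [Yinf YZ Ydec]]; exists Y; split=> // c; exact: Ydec.
have /choice[U UP] := path_ultrafilter lt_trans lt_tri pieceP Qadm i0.
have clU f : closure (range (point_trace A)) (trace A (U f)).
  have [UU _ _] := UP f; apply: trace_in_closure => c.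
  exact: in_ultra_setVsetC.
pose pt f : trace_space A := SigSub (mem_set (clU f)).
have ptinj : injective pt.
  move=> f g fg; apply/funext => k; apply: contrapT => fgk.
  have [UUf Uf _] := UP f; have [UUg Ug Ugfin] := UP g.
  have /(congr1 (fun x : cube N => x (k, f))) : trace A (U f) = trace A (U g).
    exact: (congr1 val fg).
  rewrite /trace /A /= (asboolT (Uf k)) => /esym/asboolW Ugf.
  apply: (Ugfin (node lt piece Q k f `&` node lt piece Q k g)).
    by apply: (node_almost_disjoint lt_wf lt_trans pieceP Qadm _ _ fgk); right.
  exact: filterI.
exists (trace_space A); split.
- exact: trace_space_sequentially_compact.
- exact: trace_space_separable.
- exact: trace_space_hausdorff.
apply/andP; split.
  (* an increasing sequence in [I] embeds [2^omega] into [I -> bool] *)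
  have [up upP] := choice (fun i => lt_bounded (fun=> i)).
  pose a n := iter n up i0.
  have a_lt m n : (m < n)%N -> lt (a m) (a n).
    elim: n => [//|n IH]; rewrite ltnS leq_eqVlt => /predU1P[->|/IH mn].
      exact: (upP _ 0%N).
    exact: lt_trans mn (upP _ 0%N).
  have lt_irr i : ~ lt i i.
    by elim/(well_founded_ind lt_wf): i => i IH ii; exact: (IH i ii ii).
  have ainj : injective a.
    move=> m n amn; have [/a_lt|/a_lt|//] := ltngtP m n;
      by rewrite amn => /lt_irr.
  apply/card_le_injectiveP.
  exists (fun S : set nat =>
    pt (fun i => `[< exists2 n, a n = i & S n >])) => //.
  move=> S S' /ptinj SS'.
  have mem (R : set nat) n : `[< exists2 m, a m = a n & R m >] <-> R n.
    split=> [/asboolP[m /ainj->]//|Rn]; apply/asboolP.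
    by exists n.
  apply/seteqP; split=> n /mem.
    by rewrite (congr1 (fun h => h (a n)) SS') => /mem.
  by rewrite -(congr1 (fun h => h (a n)) SS') => /mem.
apply/negP => /card_le_injectiveP[phi phiinj _]; apply: Ilarge.
by exists (phi \o pt) => f g /phiinj/ptinj.
Qed.

Theorem corollary4p11 :
  (card_lt continuum (power_set pseudointersection_number) ->
   exists X : topologicalType,
     [/\ sequentially_compact X, separable_space X, hausdorff_space X &
         card_lt continuum [set: X]])
  /\
  (pseudointersection_number #= continuum ->
   exists X : topologicalType,
     [/\ sequentially_compact X, separable_space X, hausdorff_space X &
         card_lt continuum [set: X]]).
Proof.
split=> [|p_c]; first exact: sequentially_compact_separable_large.
apply: sequentially_compact_separable_large.
have [c_p p_le_c] : continuum #<= pseudointersection_number /\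
    pseudointersection_number #<= continuum.
  by move: p_c; rewrite card_eq_le => /andP[].
apply/andP; split.
  apply: card_le_trans c_p _.
  rewrite -(card_le_eql (inj_card_eq (f := fun x => [set x]) _)); last first.
    move=> x y _ _ xy; have : [set x] x by [].
    by rewrite xy.
  by apply: subset_card_le => _ [x px <-] _ ->.
by apply/negP => /card_le_trans/(_ c_p); exact: cantor_card.
Qed.
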